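(* Let $0<c<2$ and $n=m=N/2\to\infty$, and consider the pencil $\mathcal{A}_{m;c}(\lambda)=H_{2m;c}-\lambda D_{m,m}$ of $2m\times 2m$ matrices. The eigenvalues $\lambda$ of $\mathcal{A}_{m;c}$ that satisfy $0<|\operatorname{Re}(\lambda)|<2-c$ also satisfy $$|\operatorname{Im}(\lambda)|\le\frac{\Lambda_c(|\operatorname{Re}(\lambda)|)}{2m}+o(m^{-1}),$$ where $$\Lambda_c(u):=X_{c,u}^{-1}\left(\tan\left(\frac12\arccos\left(\frac{u-c}{2}\right)\right)\tan\left(\frac12\arccos\left(\frac{u+c}{2}\right)\right)\right),$$ and $X_{c,u}^{-1}$ is the inverse of the monotonic increasing analytic function $X_{c,u}:(0,\infty)\to(0,1)$ defined by $$X_{c,u}(v):=\tanh\left(\frac{v}{2\sqrt{4-(u-c)^2}}\right)\tanh\left(\frac{v}{2\sqrt{4-(u+c)^2}}\right).$$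
   Context: Here $N=2m$ is the size of the matrices. $H_{2m;c}$ is the real symmetric tridiagonal $2m\times 2m$ matrix with entries $c$ on the diagonal, $1$ where $|r-s|=1$, and $0$ otherwise. $D_{m,n}$ is the diagonal matrix whose first $m$ diagonal entries are $1$ and whose last $n$ diagonal entries are $-1$; here $n=m$. A number $\lambda\in\mathbb{C}$ is an eigenvalue of the pencil $H-\lambda D$ if $H-\lambda D$ is not invertible. *)

(* Defs.v *)
From HB Require Import structures.
From mathcomp Require Import all_boot all_order all_algebra.
From mathcomp Require Import complex.
From mathcomp Require Import all_classical all_reals all_analysis.

Set Implicit Arguments.
Unset Strict Implicit.
Unset Printing Implicit Defensive.

Import Order.TTheory GRing.Theory Num.Theory.
Import numFieldNormedType.Exports.
Local Open Scope classical_set_scope.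
Local Open Scope ring_scope.
Local Open Scope complex_scope.

Definition Hmx (R : realType) (N : nat) (c : R) : 'M[R]_N :=
  \matrix_(r < N, s < N)
    if r == s then c
    else if (r.+1 == s :> nat) || (s.+1 == r :> nat) then 1
    else 0.

Definition Dmx (R : realType) (m n : nat) : 'M[R]_(m + n) :=
  diag_mx (\row_(i < m + n) if (i < m)%N then 1 else -1).

Definition pencil (R : realType) (m : nat) (c : R) (lambda : R[i]) :
    'M[R[i]]_(m + m) :=
  map_mx (real_complex R) (Hmx (m + m) c)
    - lambda *: map_mx (real_complex R) (Dmx R m m).

Definition pencil_eigenvalue (R : realType) (m : nat) (c : R)
    (lambda : R[i]) : Prop :=
  pencil m c lambda \notin unitmx.

Definition tanh (R : realType) (x : R) : R :=
  (expR x - expR (- x)) / (expR x + expR (- x)).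

Definition X (R : realType) (c u v : R) : R :=
  tanh (v / (2 * Num.sqrt (4 - (u - c) ^+ 2)))
    * tanh (v / (2 * Num.sqrt (4 - (u + c) ^+ 2))).

(* For 0 < c < 2 and 0 < u < 2 - c, [X c u] is an increasing bijection from
   ]0, +oo[ onto ]0, 1[; ['pinv_] inverts it on its image, and the default 0
   is only used outside that image. *)
Definition Xinv (R : realType) (c u : R) : R -> R :=
  'pinv_(fun=> 0) `]0, +oo[%classic (X c u).

Definition Lambda (R : realType) (c u : R) : R :=
  Xinv c u (tan (acos ((u - c) / 2) / 2) * tan (acos ((u + c) / 2) / 2)).

(* Main.v *)
(* Write c - lambda = z + 1/z and c + lambda = w + 1/w with |z|, |w| < 1, and set
   Q1 = z^(2m+1), Q2 = w^(2m+1), f(t) = (1 - t)/(1 + t).  The three-term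
   recurrence for a kernel vector turns the eigenvalue condition into
     f(Q1) f(w) = - f(Q2) f(z).
   Taking moduli gives f(|Q1|) f(|Q2|) <= |f(w)/f(z)|.  The left-hand side is a
   product of two hyperbolic tangents which is X_{c,u}(2m |Im lambda|) to first
   order in Im lambda, and at Im lambda = 0 the right-hand side is the product K
   of the two half-angle tangents in Lambda_c(u).  Both errors must be controlled
   uniformly in u = |Re lambda|.  For this, f(w)^2 - f(z)^2 is a multiple of
   lambda, while f(w)^2/f(z)^2 = 1 + O(|Q1| + |Q2|) by the equation, so
   |Im lambda| = O(exp(- m |Im lambda| / 2)) and hence m |Im lambda|^2 -> 0.
   Both 1 - X and 1 - K vanish as u -> 0, so the errors are measured relative to
   1 - K.  Near u = 2 - c, where 4 - (u + c)^2
   degenerates, |f(w)/f(z)| is small, which directly forces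
   2m |Im lambda| -> 0. *)

Require Import Defs.
From HB Require Import structures.
From mathcomp Require Import all_boot all_order all_algebra.
From mathcomp Require Import complex.
From mathcomp Require Import all_classical all_reals all_analysis.
From mathcomp Require Import ring lra zify.
Import Order.TTheory GRing.Theory Num.Theory.
Import numFieldNormedType.Exports.
Local Open Scope classical_set_scope.
Local Open Scope ring_scope.
Local Open Scope complex_scope.

Set Implicit Arguments.
Unset Strict Implicit.
Unset Printing Implicit Defensive.

(** * The scalar three-term recurrence *)

(** Up to the sign (-1)^(n-1), this is the Chebyshev polynomial of the second kind U_{n-1} evaluated
    at x/2. *)
Fixpoint tridiag_sol (F : pzRingType) (x : F) (n : nat) : F :=
  match n with
  | 0 => 0
  | k.+1 => match k with
            | 0 => 1
            | j.+1 => - (x * tridiag_sol x k) - tridiag_sol x j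
            end
  end.

Lemma tridiag_solSS (F : pzRingType) (x : F) (n : nat) :
  tridiag_sol x n.+2 = - (x * tridiag_sol x n.+1) - tridiag_sol x n.
Proof. by []. Qed.

Lemma tridiag_sol_uniq (F : comPzRingType) (x : F) (V : nat -> F) (n : nat) :
  V 0%N = 0 ->
  (forall k, (k < n)%N -> V k + x * V k.+1 + V k.+2 = 0) ->
  forall k, (k <= n.+1)%N -> V k = V 1%N * tridiag_sol x k.
Proof.
move=> V0 Vrec k.
suff: ((k <= n.+1)%N -> V k = V 1%N * tridiag_sol x k) /\
      ((k <= n)%N -> V k.+1 = V 1%N * tridiag_sol x k.+1) by case.
elim: k => [|k [IH1 IH2]]; first by split=> _ /=; rewrite ?V0 ?mulr0 ?mulr1.
split=> [|kn]; first by rewrite ltnS; exact: IH2.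
have := Vrec k kn; rewrite tridiag_solSS IH1 ?IH2; try lia.
move=> /eqP; rewrite addrC addr_eq0 => /eqP ->; ring.
Qed.

(* z is e^{i theta} for x = 2 cos theta; the sign (-1)^n comes from solving
   V k + x V (k+1) + V (k+2) = 0 rather than the Chebyshev recurrence. *)
Lemma tridiag_sol_closed (F : comPzRingType) (x z : F) (n : nat) :
  z ^+ 2 + 1 = x * z ->
  (- z) ^+ n * tridiag_sol x n * (1 - z ^+ 2) = z * (z ^+ (n + n) - 1).
Proof.
move=> zx.
suff: (- z) ^+ n * tridiag_sol x n * (1 - z ^+ 2) = z * (z ^+ (n + n) - 1) /\
      (- z) ^+ n.+1 * tridiag_sol x n.+1 * (1 - z ^+ 2)
        = z * (z ^+ (n.+1 + n.+1) - 1) by case.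
elim: n => [|n [IH1 IH2]]; first by split=> /=; rewrite ?expr1; ring.
split=> //; rewrite tridiag_solSS.
have -> : (- z) ^+ n.+2 * (- (x * tridiag_sol x n.+1) - tridiag_sol x n)
    * (1 - z ^+ 2) = (x * z) * ((- z) ^+ n.+1 * tridiag_sol x n.+1 * (1 - z ^+ 2))
   - z ^+ 2 * ((- z) ^+ n * tridiag_sol x n * (1 - z ^+ 2)) by rewrite !exprS; ring.
by rewrite IH1 IH2 -zx !addnS !addSn !exprS; ring.
Qed.

(** This strict growth later excludes that c - lambda and c + lambda both have modulus at least 2,
    which bounds lambda. *)
Lemma tridiag_sol_norm_lt (F : numDomainType) (x : F) (n : nat) :
  2 <= `|x| -> `|tridiag_sol x n| < `|tridiag_sol x n.+1|.
Proof.
move=> x2; elim: n => [|n IH]; first by rewrite /= normr0 normr1 ltr01.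
rewrite tridiag_solSS -opprD normrN.
apply: lt_le_trans (lerB_normD _ _).
rewrite normrM ltrBrDr.
apply: (@lt_le_trans _ _ (2 * `|tridiag_sol x n.+1|)).
  by rewrite mulr2n mulrDl !mul1r ltrD2l.
exact: ler_wpM2r.
Qed.

(** * From a kernel vector to a scalar equation *)

(** Shifting the index by one and padding with 0 at both ends makes the first and last equations
    instances of the same recurrence. The 0 at index N+1 is the default of [insub]. *)
Lemma tridiag_kernelP (F : pzRingType) (N : nat) (d : nat -> F) (A : 'M[F]_N)
    (v : 'rV[F]_N) :
  (forall i j : 'I_N, A i j = d i *+ (i == j :> nat) + (i.+1 == j :> nat)%:R
     + (j.+1 == i :> nat)%:R) ->
  v *m A = 0 ->
  exists V : nat -> F, [/\ V 0%N = 0, V N.+1 = 0,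
    forall i : 'I_N, v 0 i = V i.+1 &
    forall k, (k < N)%N -> V k + V k.+1 * d k + V k.+2 = 0].
Proof.
move=> AE vA0.
pose V k := if k is k'.+1 then
  (if insub k' is Some i then v 0 (i : 'I_N) else 0) else 0.
have VE (i : 'I_N) : v 0 i = V i.+1 by rewrite /= valK.
have Vout : V N.+1 = 0 by rewrite /= insubF // ltnn.
have V0 : V 0%N = 0 by [].
clearbody V.
have sumE (k : nat) : (k <= N)%N ->
    \sum_(i < N) v 0 i *+ (i == k :> nat) = V k.+1.
  rewrite leq_eqVlt => /orP[/eqP ->|kN].
    rewrite Vout big1 // => i _; rewrite (_ : (_ == _) = false) //.
    by apply/negbTE; rewrite neq_ltn ltn_ord.
  rewrite (bigD1 (Ordinal kN)) //= eqxx mulr1n big1 ?addr0.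
    by rewrite VE.
  by move=> i; rewrite -val_eqE /= => /negbTE ->.
exists V; split=> // k kN.
have := congr1 (fun M : 'rV_N => M 0 (Ordinal kN)) vA0; rewrite !mxE.
under eq_bigr => i _ do rewrite AE /= !mulrDr mulrnAr !mulr_natr.
rewrite !big_split /= => <-; rewrite [V k + _]addrC.
congr (_ + _ + _).
- rewrite -sumE ?(ltnW kN) // mulr_suml; apply: eq_bigr => i _.
  by case: eqP => [->|_]; rewrite ?mulr1n ?mulr0n ?mul0r ?mulr0.
- case: k kN => [|k] kN; first by rewrite big1 // => i _; rewrite mulr0n.
  by rewrite -sumE ?(ltnW (ltnW kN)) //; apply: eq_bigr => i _; rewrite eqSS mulr1.
- by rewrite -sumE //; apply: eq_bigr => i _; rewrite eq_sym.
Qed.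

(** A kernel vector solves the recurrence for a from the left end and, read backwards, the one for b
    from the right end. Matching the two solutions at the middle indices m and m+1 is a 2x2 linear
    system, whose determinant must vanish. *)
Lemma pencil_eigenvalue_tridiag (R : realType) (m : nat) (c : R)
    (lambda : R[i]) :
  (0 < m)%N -> pencil_eigenvalue m c lambda ->
  tridiag_sol (c%:C - lambda) m * tridiag_sol (c%:C + lambda) m =
  tridiag_sol (c%:C - lambda) m.+1 * tridiag_sol (c%:C + lambda) m.+1.
Proof.
move=> m0; set a := c%:C - lambda; set b := c%:C + lambda.
rewrite /pencil_eigenvalue unitmxE unitfE negbK => /det0P[v v0].
pose d (k : nat) := if (k < m)%N then a else b.
case/(@tridiag_kernelP _ _ d) => [i j|V [V0 VN vE Vrec]].
  rewrite !mxE -val_eqE /d /=.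
  case: (ltngtP i j) => ij.
  - rewrite mulr0n mulr0 subr0 add0r.
    rewrite (_ : (j.+1 == i :> nat) = false); last by lia.
    by rewrite orbF; case: ifP => /= _; rewrite ?addr0.
  - rewrite mulr0n mulr0 subr0 add0r.
    rewrite (_ : (i.+1 == j :> nat) = false); last by lia.
    by rewrite /=; case: ifP => /= _; rewrite ?add0r.
  - rewrite -ij !(gtn_eqF (ltnSn _)) !addr0 mulr1n.
    case: ifP => im; rewrite /a /b ?rmorphN ?rmorph1 ?mulrN ?mulr1 ?opprK //.
(* The m equations with entry a determine V one index past the first block, so this half and the
   next overlap exactly in m and m+1. *)
have L : forall k, (k <= m.+1)%N -> V k = V 1%N * tridiag_sol a k.
  apply: tridiag_sol_uniq => // k km.
  by have := Vrec k; rewrite /d km mulrC; apply; lia.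
have L' : forall k, (k <= m.+1)%N ->
    V ((m + m).+1 - k)%N = V (m + m)%N * tridiag_sol b k.
  pose W k := V ((m + m).+1 - k)%N.
  have := @tridiag_sol_uniq _ b W m; rewrite /W !subn0 subn1; apply=> // k km.
  have kN : ((m + m) - k.+1 < m + m)%N by lia.
  have := Vrec _ kN; rewrite /d (_ : (_ < m)%N = false); last by lia.
  rewrite (_ : (m + m).+1 - k = (m + m - k.+1).+2)%N; last by lia.
  rewrite (_ : (m + m).+1 - k.+1 = (m + m - k.+1).+1)%N; last by lia.
  rewrite (_ : (m + m).+1 - k.+2 = (m + m - k.+1))%N; last by lia.
  move=> <-; ring.
have e1 := L m (leqnSn _); have e2 := L m.+1 (leqnn _).
have e3 := L' m.+1 (leqnn _); have e4 := L' m (leqnSn _).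
rewrite (_ : (m + m).+1 - m.+1 = m)%N in e3; last by lia.
rewrite (_ : (m + m).+1 - m = m.+1)%N in e4; last by lia.
(* Either end value may vanish, but not both, since together they determine the vector. The identity
   is therefore proved after multiplication by each of them. *)
have Vl : V 1%N != 0 \/ V (m + m)%N != 0.
  apply/orP; rewrite -negb_and; apply: contra v0 => /andP[/eqP Va /eqP Vb].
  apply/eqP/rowP => i; rewrite mxE vE.
  have [im|im] := leqP i m; first by rewrite L // Va mul0r.
  have -> : i.+1 = ((m + m).+1 - (m + m - i))%N by have := ltn_ord i; lia.
  by rewrite L' ?Vb ?mul0r //; lia.
have cross1 : V 1%N * (tridiag_sol a m * tridiag_sol b m -
    tridiag_sol a m.+1 * tridiag_sol b m.+1) = 0.
  have -> : V 1%N * (tridiag_sol a m * tridiag_sol b m -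
    tridiag_sol a m.+1 * tridiag_sol b m.+1) =
    (V 1%N * tridiag_sol a m) * tridiag_sol b m -
    (V 1%N * tridiag_sol a m.+1) * tridiag_sol b m.+1 by ring.
  rewrite -e1 -e2 e3 e4; ring.
have cross2 : V (m + m)%N * (tridiag_sol a m * tridiag_sol b m -
    tridiag_sol a m.+1 * tridiag_sol b m.+1) = 0.
  have -> : V (m + m)%N * (tridiag_sol a m * tridiag_sol b m -
    tridiag_sol a m.+1 * tridiag_sol b m.+1) =
    (V (m + m)%N * tridiag_sol b m) * tridiag_sol a m -
    (V (m + m)%N * tridiag_sol b m.+1) * tridiag_sol a m.+1 by ring.
  rewrite -e4 -e3 e1 e2; ring.
apply/eqP; rewrite -subr_eq0.
case: Vl => /negbTE Vn.
  by move/eqP: cross1; rewrite mulf_eq0 Vn.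
by move/eqP: cross2; rewrite mulf_eq0 Vn.
Qed.

(** * Complex moduli, the Joukowski map and real constraints on an eigenvalue *)

Import ComplexField.Normc.

Lemma normc_sqr (R : rcfType) (z : R[i]) :
  normc z ^+ 2 = complex.Re z ^+ 2 + complex.Im z ^+ 2.
Proof. by case: z => x y /=; rewrite sqr_sqrtr // addr_ge0 // sqr_ge0. Qed.

Lemma normc_ge0 (R : rcfType) (z : R[i]) : 0 <= normc z.
Proof. by case: z => x y /=; exact: sqrtr_ge0. Qed.

Lemma normc_gt0 (R : rcfType) (z : R[i]) : z != 0 -> 0 < normc z.
Proof.
move=> z0; rewrite lt_def normc_ge0 andbT; apply: contra z0 => /eqP /eq0_normc.
by move=> ->.
Qed.

Lemma normcX (R : rcfType) (z : R[i]) (n : nat) : normc (z ^+ n) = normc z ^+ n.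
Proof.
by elim: n => [|n IH]; rewrite ?expr0 ?exprS ?normcM ?IH // normc1.
Qed.

Lemma ler_normc_Im (R : rcfType) (z : R[i]) : `|complex.Im z| <= normc z.
Proof.
rewrite -(@ler_pXn2r _ 2%N) ?nnegrE ?normr_ge0 ?normc_ge0 //.
by rewrite normc_sqr real_normK ?num_real // lerDr sqr_ge0.
Qed.

Lemma ler_normcB (R : rcfType) (z w : R[i]) : normc z - normc w <= normc (z + w).
Proof.
have := le_normcD (z + w) (- w).
by rewrite addrK normcN lerBlDr.
Qed.

(* With |z| = e^{-eta}, S is 4 sinh(eta)^2 and the last identity is the equation
   of the ellipse that is the image of the circle of radius |z|. *)
Lemma joukowski_root (R : rcfType) (a : R[i]) : complex.Im a != 0 ->
  exists z : R[i], [/\ z ^+ 2 + 1 = a * z, 0 < normc z < 1 &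
    forall S, S = ((normc z)^-1 - normc z) ^+ 2 ->
    complex.Re a ^+ 2 * S + complex.Im a ^+ 2 * (4 + S) = S * (4 + S)].
Proof.
move=> a0.
have [t tE] : exists t : R[i], t ^+ 2 = a ^+ 2 - 4.
  by exists (sqrtC (a ^+ 2 - 4)); rewrite sqrtCK.
pose z1 := (a + t) / 2; pose z2 := (a - t) / 2.
have z12 : z1 * z2 = 1.
  have -> : z1 * z2 = (a ^+ 2 - t ^+ 2) / 4 by rewrite /z1 /z2; field.
  by rewrite tE; field.
have e1 : z1 ^+ 2 + 1 = a * z1.
  by rewrite -z12 /z1 /z2; field.
have e2 : z2 ^+ 2 + 1 = a * z2.
  by rewrite -z12 /z1 /z2; field.
(* Real and imaginary parts of a = z + 1/z times |z|^2, where 1/z is the conjugate of z divided by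
   |z|^2. *)
have key z : z ^+ 2 + 1 = a * z -> z != 0 ->
    complex.Re a * normc z ^+ 2 = complex.Re z * (normc z ^+ 2 + 1) /\
    complex.Im a * normc z ^+ 2 = complex.Im z * (normc z ^+ 2 - 1).
  case: z => x y; case: (a) => A B; rewrite normc_sqr /= expr2.
  move=> /eqP; rewrite eq_complex /= => /andP[/eqP h1 /eqP h3] _.
  have k1 : x * x - y * y + 1 = A * x - B * y by rewrite -h1; ring.
  have k2 : x * y + y * x = A * y + B * x by rewrite -h3; ring.
  split.
    have -> : A * (x ^+ 2 + y ^+ 2) = (A * x - B * y) * x + (A * y + B * x) * y by ring.
    by rewrite -k1 -k2; ring.
  have -> : B * (x ^+ 2 + y ^+ 2) = (A * y + B * x) * x - (A * x - B * y) * y by ring.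
  by rewrite -k1 -k2; ring.
have nz z : z ^+ 2 + 1 = a * z -> z != 0.
  move=> e; apply/eqP => z0; move: e; rewrite z0 mulr0 expr0n /= add0r => /eqP.
  by rewrite oner_eq0.
(* On the unit circle z + 1/z is real. Hence one of the two roots, whose product is 1, lies strictly
   inside. *)
have nn z : z ^+ 2 + 1 = a * z -> normc z != 1.
  move=> e; apply/eqP => n1; have [_] := key z e (nz z e).
  by rewrite n1 expr1n subrr mulr0 mulr1; apply/eqP.
have [z [ez nz1]] : exists z, z ^+ 2 + 1 = a * z /\ normc z < 1.
  case: (ltP (normc z1) 1) => h; first by exists z1.
  exists z2; split=> //.
  have h1 : 1 < normc z1 by rewrite lt_def nn.
  have := congr1 (@normc R) z12; rewrite normcM normc1 => hh.
  rewrite -hh ltr_pMl //; exact: normc_gt0 (nz _ e2).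
exists z; split=> //.
  by rewrite nz1 normc_gt0 // nz.
move=> S ->.
have [k1 k2] := key z ez (nz z ez).
have n0 := normc_gt0 (nz z ez).
set n := normc z in n0 k1 k2 *.
have n0' : n != 0 by rewrite gt_eqF.
have -> : complex.Re a = complex.Re z * (n ^+ 2 + 1) / n ^+ 2 by rewrite -k1; field.
have -> : complex.Im a = complex.Im z * (n ^+ 2 - 1) / n ^+ 2 by rewrite -k2; field.
have hx : complex.Re z ^+ 2 = n ^+ 2 - complex.Im z ^+ 2.
  by rewrite /n normc_sqr addrK.
rewrite !expr_div_n !exprMn hx.
by field.
Qed.

(* rho1 = |z|, rho2 = |w| and G = |f(w)/f(z)| in the notation of the header. *)
Lemma eigenvalue_constraints (R : realType) (m : nat) (c : R) (lambda : R[i]) :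
  0 < c < 2 ->
  tridiag_sol (c%:C - lambda) m * tridiag_sol (c%:C + lambda) m =
  tridiag_sol (c%:C - lambda) m.+1 * tridiag_sol (c%:C + lambda) m.+1 ->
  complex.Im lambda != 0 ->
  let u := complex.Re lambda in let y := complex.Im lambda in
  exists rho1 rho2 G : R, let r := rho1 ^+ (m + m).+1 in
    let s := rho2 ^+ (m + m).+1 in
  [/\ 0 < rho1 < 1 /\ 0 < rho2 < 1,
      (forall S, S = (rho1^-1 - rho1) ^+ 2 ->
         (c - u) ^+ 2 * S + y ^+ 2 * (4 + S) = S * (4 + S)) /\
      (forall S, S = (rho2^-1 - rho2) ^+ 2 ->
         (c + u) ^+ 2 * S + y ^+ 2 * (4 + S) = S * (4 + S)),
      0 <= G /\
      G ^+ 4 * (((2 - c + u) ^+ 2 + y ^+ 2) * ((2 + c + u) ^+ 2 + y ^+ 2)) =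
        ((2 - c - u) ^+ 2 + y ^+ 2) * ((2 + c - u) ^+ 2 + y ^+ 2),
      (1 - r) * (1 - s) <= G * ((1 + r) * (1 + s)) &
      `|y| <= 2 /\ `|y| <= 1024 * (r + s)].
Proof.
move=> /andP[c0 c2] rec y0 u y.
pose a := c%:C - lambda; pose b := c%:C + lambda.
have Rea : complex.Re a = c - u by rewrite /a /u; case: (lambda).
have Ima : complex.Im a = - y by rewrite /a /y; case: (lambda) => ? ? /=; rewrite add0r.
have Reb : complex.Re b = c + u by rewrite /b /u; case: (lambda).
have Imb : complex.Im b = y by rewrite /b /y; case: (lambda) => ? ? /=; rewrite add0r.
have [z [za /andP[zn0 zn1] zS]] : exists z : R[i],
    [/\ z ^+ 2 + 1 = a * z, 0 < normc z < 1 & forall S, S = ((normc z)^-1 - normc z) ^+ 2 ->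
    complex.Re a ^+ 2 * S + complex.Im a ^+ 2 * (4 + S) = S * (4 + S)].
  by apply: joukowski_root; rewrite Ima oppr_eq0.
have [w [wb /andP[wn0 wn1] wS]] : exists w : R[i],
    [/\ w ^+ 2 + 1 = b * w, 0 < normc w < 1 & forall S, S = ((normc w)^-1 - normc w) ^+ 2 ->
    complex.Re b ^+ 2 * S + complex.Im b ^+ 2 * (4 + S) = S * (4 + S)].
  by apply: joukowski_root; rewrite Imb.
have z0 : z != 0 by apply/eqP => e; move: zn0; rewrite e normc0 ltxx.
have w0 : w != 0 by apply/eqP => e; move: wn0; rewrite e normc0 ltxx.
rewrite -/a -/b in rec.
pose n := (m + m).+1.
pose Q1 := z ^+ n; pose Q2 := w ^+ n.
(* The closed forms at m and m+1 contain z^(2m) and z^(2m+2), that is Q1/z and z Q1; hence the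
   exponent 2m+1. *)
have mixed : (z * Q1 - 1) * (w * Q2 - 1) = (Q1 - z) * (Q2 - w).
  have [e1 e2] := (tridiag_sol_closed m za, tridiag_sol_closed m.+1 za).
  have [f1 f2] := (tridiag_sol_closed m wb, tridiag_sol_closed m.+1 wb).
  apply: (mulfI z0); apply: (mulfI w0).
  have -> : w * (z * ((z * Q1 - 1) * (w * Q2 - 1))) =
     (z * (z ^+ (m.+1 + m.+1) - 1)) * (w * (w ^+ (m.+1 + m.+1) - 1)).
    by rewrite /Q1 /Q2 /n !addnS !addSn !exprS; ring.
  have -> : w * (z * ((Q1 - z) * (Q2 - w))) =
     z * w * (z * (z ^+ (m + m) - 1)) * (w * (w ^+ (m + m) - 1)).
    by rewrite /Q1 /Q2 /n !exprS; ring.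
  rewrite -e1 -e2 -f1 -f2.
  transitivity ((- z) ^+ m.+1 * (- w) ^+ m.+1 * (1 - z ^+ 2) * (1 - w ^+ 2)
    * (tridiag_sol a m.+1 * tridiag_sol b m.+1)); first by ring.
  by rewrite -rec !exprS; ring.
pose N := (1 - Q1) * (1 + Q2); pose D := (1 + Q1) * (1 - Q2).
(* This is f(Q1) f(w) = - f(Q2) f(z) with denominators cleared. *)
have main : N * ((1 - w) * (1 + z)) = - (D * ((1 - z) * (1 + w))).
  apply/eqP; rewrite -addr_eq0; apply/eqP.
  transitivity (2 * ((z * Q1 - 1) * (w * Q2 - 1) - (Q1 - z) * (Q2 - w))).
    by rewrite /N /D; ring.
  by rewrite mixed subrr mulr0.
(* These four squares give f(z)^2 = (a-2)/(a+2) and f(w)^2 = (b-2)/(b+2), so squaring [main]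
   eliminates z and w outside Q1 and Q2. *)
have zp : (1 + z) ^+ 2 = z * (a + 2) by rewrite [RHS]mulrDr [z * a]mulrC -za; ring.
have zm : (1 - z) ^+ 2 = z * (a - 2) by rewrite [RHS]mulrBr [z * a]mulrC -za; ring.
have wp : (1 + w) ^+ 2 = w * (b + 2) by rewrite [RHS]mulrDr [w * b]mulrC -wb; ring.
have wm : (1 - w) ^+ 2 = w * (b - 2) by rewrite [RHS]mulrBr [w * b]mulrC -wb; ring.
(* Here (b-2)(a+2) - (a-2)(b+2) = 8 lambda and D^2 - N^2 = 4 (Q1-Q2)(1 - Q1 Q2): lambda is small
   when Q1 and Q2 are. *)
have lamE : D ^+ 2 * (8 * lambda) = (b - 2) * (a + 2) * (4 * (Q1 - Q2) * (1 - Q1 * Q2)).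
  have sq : N ^+ 2 * ((b - 2) * (a + 2)) = D ^+ 2 * ((a - 2) * (b + 2)).
    apply: (mulfI z0); apply: (mulfI w0).
    transitivity ((N * ((1 - w) * (1 + z))) ^+ 2).
      by rewrite !exprMn zp wm; ring.
    by rewrite main sqrrN !exprMn zm wp; ring.
  transitivity (D ^+ 2 * ((b - 2) * (a + 2)) - N ^+ 2 * ((b - 2) * (a + 2))).
    by rewrite sq /a /b; ring.
  by rewrite /D /N; ring.
have nQ1 : normc Q1 = normc z ^+ n by exact: normcX.
have nQ2 : normc Q2 = normc w ^+ n by exact: normcX.
have n1 (v : R[i]) : normc v < 1 -> 0 < normc (1 + v) /\ 0 < normc (1 - v).
  move=> v1; split; [have := ler_normcB 1 v|have := ler_normcB 1 (- v)];
  rewrite ?normcN normc1; lra.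
have nb (v : R[i]) : 1 - normc v <= normc (1 - v) /\ normc (1 + v) <= 1 + normc v.
  by have := ler_normcB 1 (- v); have := le_normcD 1 v; rewrite normcN normc1.
have nb' (v : R[i]) : 1 - normc v <= normc (1 + v) /\ normc (1 - v) <= 1 + normc v.
  by have := ler_normcB 1 v; have := le_normcD 1 (- v); rewrite normcN normc1.
set r := normc z ^+ n in nQ1; set s := normc w ^+ n in nQ2.
have r0 : 0 < r by exact: exprn_gt0.
have s0 : 0 < s by exact: exprn_gt0.
have r1 : r < 1 by apply: exprn_ilt1 => //; exact: ltW.
have s1 : s < 1 by apply: exprn_ilt1 => //; exact: ltW.
have [[z1p z1m] [w1p w1m]] := (n1 z zn1, n1 w wn1).
pose G := normc (1 - w) * normc (1 + z) / (normc (1 - z) * normc (1 + w)).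
have GE : normc N * G = normc D.
  have h : normc N * (normc (1 - w) * normc (1 + z)) =
      normc D * (normc (1 - z) * normc (1 + w)) by rewrite -!normcM main normcN.
  by rewrite /G mulrA h mulfK // mulf_neq0 // gt_eqF.
exists (normc z), (normc w), G; split.
- by rewrite zn0 zn1 wn0 wn1.
- split=> S SE; first by have := zS S SE; rewrite Rea Ima sqrrN.
  by have := wS S SE; rewrite Reb Imb.
- split; first by rewrite /G divr_ge0 // mulr_ge0 // ltW.
  have sqn (v : R[i]) k : normc (v + k%:C) ^+ 2 =
     (complex.Re v + k) ^+ 2 + complex.Im v ^+ 2.
    by rewrite normc_sqr; case: (v) => ? ? /=; rewrite addr0.
  have toC (v : R[i]) : v + 2 = v + (2 : R)%:C by rewrite rmorph_nat.
  have toC' (v : R[i]) : v - 2 = v + (- 2 : R)%:C by rewrite rmorphN rmorph_nat.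
  have -> : (2 - c + u) ^+ 2 + y ^+ 2 = normc (a - 2) ^+ 2.
    by rewrite toC' sqn Rea Ima; ring.
  have -> : (2 + c + u) ^+ 2 + y ^+ 2 = normc (b + 2) ^+ 2.
    by rewrite toC sqn Reb Imb; ring.
  have -> : (2 - c - u) ^+ 2 + y ^+ 2 = normc (b - 2) ^+ 2.
    by rewrite toC' sqn Reb Imb; ring.
  have -> : (2 + c - u) ^+ 2 + y ^+ 2 = normc (a + 2) ^+ 2.
    by rewrite toC sqn Rea Ima; ring.
  have en (v t x : R[i]) : v ^+ 2 = t * x -> normc v ^+ 2 = normc t * normc x.
    by move=> e; rewrite -normcX e normcM.
  have [ezp ezm] := (en _ _ _ zp, en _ _ _ zm).
  have [ewp ewm] := (en _ _ _ wp, en _ _ _ wm).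
  have l1 : normc (a + 2) = normc (1 + z) ^+ 2 / normc z by rewrite ezp; field; rewrite gt_eqF.
  have l2 : normc (a - 2) = normc (1 - z) ^+ 2 / normc z by rewrite ezm; field; rewrite gt_eqF.
  have l3 : normc (b + 2) = normc (1 + w) ^+ 2 / normc w by rewrite ewp; field; rewrite gt_eqF.
  have l4 : normc (b - 2) = normc (1 - w) ^+ 2 / normc w by rewrite ewm; field; rewrite gt_eqF.
  rewrite l1 l2 l3 l4 /G; field.
  by rewrite !gt_eqF.
- have [_ q1p] := nb Q1; have [q1m q1m'] := nb' Q1; rewrite !nQ1 in q1p q1m q1m'.
  have [q2m q2p] := nb Q2; rewrite !nQ2 in q2p q2m.
  have Dl : (1 - r) * (1 - s) <= normc D.
    by rewrite /D normcM; apply: ler_pM; rewrite // subr_ge0 ltW.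
  apply: (le_trans Dl); rewrite -GE mulrC; apply: ler_wpM2l.
    by rewrite /G divr_ge0 // mulr_ge0 // ltW.
  by rewrite /N normcM; apply: ler_pM; rewrite ?normc_ge0.
(* Otherwise both factors on the right of [rec] would strictly exceed those on the left in
   modulus. *)
- have ab : normc a < 2 \/ normc b < 2.
    have nE (v : R[i]) : `|v| = (normc v)%:C by [].
    have n2E : (2 : R[i]) = (2 : R)%:C by rewrite rmorph_nat.
    case: (ltP (normc a) 2) => ha; first by left.
    right; rewrite ltNge; apply/negP => hb.
    have ha' : 2 <= `|a| by rewrite nE n2E lecR.
    have hb' : 2 <= `|b| by rewrite nE n2E lecR.
    have := congr1 Num.norm rec; rewrite !normrM => e.
    have := @ltr_pM _ _ _ _ _ (normr_ge0 _) (normr_ge0 _)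
      (tridiag_sol_norm_lt m ha') (tridiag_sol_norm_lt m hb').
    by rewrite e ltxx.
  have nc : normc (c%:C) = c by rewrite /= expr0n addr0 sqrtr_sqr gtr0_norm.
  have lam4 : normc lambda <= 4.
    case: ab => h.
      have -> : lambda = c%:C + (- a) by rewrite /a; ring.
      by have := le_normcD c%:C (- a); rewrite (normcN a) nc; lra.
    have -> : lambda = b + - c%:C by rewrite /b; ring.
    by have := le_normcD b (- c%:C); rewrite (normcN c%:C) nc; lra.
  have y2 : `|y| <= 2.
    case: ab => h.
      have := ler_normc_Im a; rewrite Ima normrN; lra.
    have := ler_normc_Im b; rewrite Imb; lra.
  split=> //; rewrite -/n -/r -/s.
  (* For r + s >= 1/2 the bound |y| <= 2 suffices. Otherwise |D| >= 1/4, and [lamE] gives |lambda|/2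
     <= 8 * 8 * 4 * 2 (r + s), hence 1024. *)
  case: (ltP (r + s) (2^-1)) => rs; last by lra.
  have nk (k : nat) : normc (k%:R : R[i]) = k%:R.
    by rewrite -(rmorph_nat (real_complex R)) /= expr0n addr0 sqrtr_sqr ger0_norm.
  have b2 : normc (b - 2) <= 8.
    have := le_normcD b (- 2); have := le_normcD c%:C lambda.
    rewrite normcN nk nc -/b; lra.
  have a2 : normc (a + 2) <= 8.
    have := le_normcD a 2; have := le_normcD c%:C (- lambda).
    rewrite normcN nk nc -/a; lra.
  have e : normc D ^+ 2 * (8 * normc lambda) = normc (b - 2) * normc (a + 2)
      * (4 * normc (Q1 - Q2) * normc (1 - Q1 * Q2)).
    by rewrite -(nk 8) -(nk 4) -normcX -!normcM lamE.
  have q1 : normc (Q1 - Q2) <= r + s by have := le_normcD Q1 (- Q2); rewrite normcN nQ1 nQ2.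
  have q2 : normc (1 - Q1 * Q2) <= 2.
    have := le_normcD 1 (- (Q1 * Q2)); rewrite normcN normc1 normcM nQ1 nQ2.
    have : r * s <= 1 by rewrite mulr_ile1 // ltW.
    lra.
  have d1 : 4^-1 <= normc D.
    rewrite /D normcM.
    have : 2^-1 * 2^-1 <= normc (1 + Q1) * normc (1 - Q2).
      apply: ler_pM; rewrite ?invr_ge0 //.
        have [+ _] := nb' Q1; rewrite nQ1; lra.
      have [+ _] := nb Q2; rewrite nQ2; lra.
    lra.
  have yl : `|y| <= normc lambda by exact: ler_normc_Im.
  have d2 : 4^-1 ^+ 2 <= normc D ^+ 2.
    by rewrite ler_pXn2r ?nnegrE ?invr_ge0 ?normc_ge0.
  have lhs : 4^-1 ^+ 2 * (8 * normc lambda) <= normc D ^+ 2 * (8 * normc lambda).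
    by apply: ler_wpM2r => //; rewrite mulr_ge0 // normc_ge0.
  have rhs : normc (b - 2) * normc (a + 2) * (4 * normc (Q1 - Q2) * normc (1 - Q1 * Q2))
      <= 8 * 8 * (4 * (r + s) * 2).
    apply: ler_pM; rewrite ?mulr_ge0 ?normc_ge0 //.
      by apply: ler_pM; rewrite ?normc_ge0.
    apply: ler_pM; rewrite ?mulr_ge0 ?normc_ge0 //.
    by rewrite ler_pM2l.
  rewrite -e in rhs; have := le_trans lhs rhs; lra.
Qed.

(** * Exponential bounds on the moduli of the roots *)

(** The function f of the overview; at h = exp(-t) it is tanh(t/2). *)
Definition cayley (F : fieldType) (h : F) : F := (1 - h) / (1 + h).

(** Since 1/(1+x) >= 1-x, a rho above 1/(1+x) would have 1/rho - rho < 2x. So rho <= 1/(1+x) <= 1-t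
    <= exp(-t). *)
Lemma expR_lower_bound (R : realType) (rho x t : R) : 0 < rho -> 0 <= x ->
  2 * x <= rho^-1 - rho -> 1 <= (1 + x) * (1 - t) -> rho <= expR (- t).
Proof.
move=> r0 x0 hx ht.
have rx : rho * (1 + x) <= 1.
  rewrite leNgt; apply/negP => h.
  have h1 : rho^-1 < 1 + x by rewrite -[rho^-1]mul1r ltr_pdivrMr // mulrC.
  have h2 : 1 - x <= rho.
    have : (1 - x) * (1 + x) <= rho * (1 + x) by apply: le_trans (ltW h); nra.
    by rewrite ler_pM2r //; lra.
  lra.
have e1 := expR_ge1Dx (- t).
have e2 : 1 <= (1 + x) * expR (- t).
  by apply: (le_trans ht); rewrite ler_pM2l; lra.
have e0 := expR_gt0 (- t).
have : rho * 1 <= rho * ((1 + x) * expR (- t)) by rewrite ler_pM2l.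
rewrite mulr1 => h; apply: (le_trans h); rewrite mulrA -[leRHS]mul1r.
by rewrite ler_pM2r.
Qed.

Section rho_bounds.
Variables (R : realType) (rho A y : R).
Hypothesis rho01 : 0 < rho < 1.
Hypothesis rhoE : forall S, S = (rho^-1 - rho) ^+ 2 ->
  A ^+ 2 * S + y ^+ 2 * (4 + S) = S * (4 + S).

Let rho0 : 0 < rho. Proof. by case/andP: rho01. Qed.

Let d0 : 0 < rho^-1 - rho.
Proof.
by case/andP: rho01 => r0 r1; rewrite subr_gt0 (lt_trans r1) // invf_gt1.
Qed.

(** Dropping A^2 S from the ellipse equation leaves S >= y^2. This holds for every A, so it also
    serves where 4 - A^2 degenerates. *)
Lemma rho_le_crude : 0 <= y <= 2 -> rho <= expR (- (y / 4)).
Proof.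
move=> /andP[y0 y2]; apply: (@expR_lower_bound _ _ (y / 2)) => //; first lra.
  have e := rhoE erefl; have e0 := d0; set d := rho^-1 - rho in e e0 *.
  have S0 : 0 <= d ^+ 2 by exact: sqr_ge0.
  have : y ^+ 2 <= d ^+ 2.
    have : y ^+ 2 * (4 + d ^+ 2) <= d ^+ 2 * (4 + d ^+ 2).
      have : 0 <= A ^+ 2 * d ^+ 2 by rewrite mulr_ge0 ?sqr_ge0.
      lra.
    by rewrite ler_pM2r //; lra.
  rewrite ler_pXn2r ?nnegrE ?(ltW e0) // => h; lra.
nra.
Qed.

(** To first order the ellipse equation reads S = 4 y^2 / s^2, that is -log rho = y/s. The factor 1
    - B y absorbs the term quadratic in S, and x - x^2 is an admissible exponent because
    (1+x)(1-x+x^2) = 1+x^3. *)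
Lemma rho_le_sharp (s B : R) : 0 < s -> s ^+ 2 = 4 - A ^+ 2 -> 0 < y <= 1 ->
  4 <= B * s ^+ 4 ->
  0 <= 1 - B * y ->
  forall x, x = y / s * (1 - B * y) -> rho <= expR (- (x - x ^+ 2)).
Proof.
move=> s0 sA /andP[y0 y1] hB By x xE.
have B0 : 0 <= B.
  rewrite -(@pmulr_lge0 _ (s ^+ 4)) ?exprn_gt0 // mulrC; lra.
have x0 : 0 <= x by rewrite xE mulr_ge0 // divr_ge0 ?ltW.
apply: (expR_lower_bound rho0 x0); last first.
  have -> : (1 + x) * (1 - (x - x ^+ 2)) = 1 + x ^+ 3 by ring.
  by rewrite lerDl exprn_ge0.
have e := rhoE erefl; have e0 := d0; set d := rho^-1 - rho in e e0 *.
rewrite leNgt; apply/negP => hd.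
have dx : d ^+ 2 < 4 * x ^+ 2.
  have -> : 4 * x ^+ 2 = (2 * x) ^+ 2 by ring.
  by rewrite ltr_pXn2r ?nnegrE ?(ltW e0) //; lra.
set S := d ^+ 2 in e dx.
have S0 : 0 <= S by exact: sqr_ge0.
(* Under the assumption S < 4 x^2 the right side turns out to be below 4 y^2; the bound 4 <= B s^4
   enters through [p4]. *)
have yS : 4 * y ^+ 2 <= S * (s ^+ 2 + S).
  have -> : S * (s ^+ 2 + S) = y ^+ 2 * (4 + S) by rewrite sA; lra.
  have : 0 <= y ^+ 2 * S by rewrite mulr_ge0 ?sqr_ge0.
  lra.
have s2 : 0 < s ^+ 2 by exact: exprn_gt0.
have lt1 : S * (s ^+ 2 + S) < 4 * x ^+ 2 * (s ^+ 2 + 4 * x ^+ 2) by nra.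
have xle : x ^+ 2 <= y ^+ 2 / s ^+ 2 * (1 - B * y).
  rewrite xE exprMn expr_div_n; apply: ler_wpM2l.
    by rewrite divr_ge0 ?sqr_ge0.
  have By' : 0 <= B * y by rewrite mulr_ge0 // ltW.
  nra.
set p := y ^+ 2 / s ^+ 2 in xle.
have p0 : 0 <= p by rewrite divr_ge0 ?sqr_ge0.
have pE : p * s ^+ 2 = y ^+ 2 by rewrite /p divfK // gt_eqF.
have p4 : 4 * p <= B * y ^+ 2 * s ^+ 2.
  have -> : 4 * p = 4 * y ^+ 2 / s ^+ 2 by rewrite /p mulrA.
  rewrite ler_pdivrMr //.
  have : y ^+ 2 * 4 <= y ^+ 2 * (B * s ^+ 4) by rewrite ler_wpM2l ?sqr_ge0.
  by rewrite (_ : s ^+ 4 = s ^+ 2 * s ^+ 2); [lra|ring].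
have x2 : 4 * x ^+ 2 <= B * y ^+ 2 * s ^+ 2.
  have By' : 0 <= B * y by rewrite mulr_ge0 // ltW.
  nra.
have x20 : 0 <= x ^+ 2 by exact: sqr_ge0.
have c1 : 4 * x ^+ 2 * (s ^+ 2 + 4 * x ^+ 2) <=
    4 * (p * (1 - B * y)) * (s ^+ 2 * (1 + B * y ^+ 2)).
  apply: ler_pM; [lra|lra|lra|nra].
have c2 : 4 * (p * (1 - B * y)) * (s ^+ 2 * (1 + B * y ^+ 2)) =
    4 * y ^+ 2 * ((1 - B * y) * (1 + B * y ^+ 2)).
  by rewrite -pE; ring.
have c3 : (1 - B * y) * (1 + B * y ^+ 2) <= 1.
  have By' : 0 <= B * y by rewrite mulr_ge0 // ltW.
  have : 0 <= B * y * (1 - y) by rewrite mulr_ge0 // subr_ge0.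
  have : 0 <= B * y * (B * y ^+ 2) by rewrite mulr_ge0 // mulr_ge0 // sqr_ge0.
  nra.
have c4 : 4 * y ^+ 2 * ((1 - B * y) * (1 + B * y ^+ 2)) <= 4 * y ^+ 2 * 1.
  by rewrite ler_wpM2l // mulr_ge0 ?sqr_ge0.
lra.
Qed.

Lemma rho_exp_le_crude (m : nat) : 0 <= y <= 2 ->
  rho ^+ (m + m).+1 <= expR (- (m%:R * y / 2)).
Proof.
move=> y02; have /andP[r0 r1] := rho01.
apply: (@le_trans _ _ (rho ^+ (m + m))).
  by rewrite exprS ger_pMl ?exprn_gt0 // ltW.
have -> : - (m%:R * y / 2) = (m + m)%:R * (- (y / 4)) by rewrite natrD; field.
rewrite expRM_natl; apply: lerXn2r; rewrite ?nnegrE ?expR_ge0 ?(ltW r0) //.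
exact: rho_le_crude.
Qed.

Lemma rho_exp_le_sharp (m : nat) (s B e : R) :
  0 < s -> s ^+ 2 = 4 - A ^+ 2 -> 0 < y <= 1 -> 4 <= B * s ^+ 4 ->
  2 * m%:R * y ^+ 2 * (B + s^-1) <= e ->
  rho ^+ (m + m).+1 <= expR (- ((2 * m%:R * y - e) / s)).
Proof.
move=> s0 sA y01 hB he; have /andP[r0 r1] := rho01; have /andP[y0 y1] := y01.
have M0 : 0 <= 2 * m%:R :> R by rewrite mulr_ge0.
have B0 : 0 <= B.
  rewrite -(@pmulr_lge0 _ (s ^+ 4)) ?exprn_gt0 // mulrC; lra.
have si : 0 < s^-1 by rewrite invr_gt0.
(* If B y > 1, then 2 m y <= e and the claimed bound is at least 1. *)
have [By|By] := leP 0 (1 - B * y); last first.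
  apply: (@le_trans _ _ 1); first by rewrite exprn_ile1 // ltW.
  rewrite -[leLHS]expR0 ler_expR oppr_ge0 pmulr_lle0 //.
  have : 2 * m%:R * y <= 2 * m%:R * (y * (y * (B + s^-1))).
    apply: ler_wpM2l => //; rewrite -[leLHS]mulr1; apply: ler_wpM2l; first exact: ltW.
    have : 0 <= y * s^-1 by rewrite mulr_ge0 // ltW.
    lra.
  have -> : 2 * m%:R * (y * (y * (B + s^-1))) = 2 * m%:R * y ^+ 2 * (B + s^-1) by ring.
  lra.
pose x := y / s * (1 - B * y).
have hx := rho_le_sharp s0 sA y01 hB By (erefl x).
apply: (@le_trans _ _ (rho ^+ (m + m))).
  by rewrite exprS ger_pMl ?exprn_gt0 // ltW.
apply: (@le_trans _ _ (expR (- (x - x ^+ 2)) ^+ (m + m))).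
  by apply: lerXn2r; rewrite ?nnegrE ?expR_ge0 ?(ltW r0).
rewrite -expRM_natl ler_expR natrD mulrN lerN2.
have x0 : 0 <= x by rewrite /x mulr_ge0 // divr_ge0 ?ltW.
have xy : x <= y / s.
  by rewrite /x ger_pMr ?divr_gt0 // gerBl mulr_ge0 // ltW.
have ys0 : 0 <= y / s by rewrite divr_ge0 // ltW.
have x2 : x ^+ 2 <= (y / s) ^+ 2 by rewrite ler_pXn2r ?nnegrE.
have : 2 * m%:R * (x - x ^+ 2) >= 2 * m%:R * (x - (y / s) ^+ 2).
  by rewrite ler_wpM2l //; lra.
have : 2 * m%:R * (x - (y / s) ^+ 2) =
   (2 * m%:R * y - 2 * m%:R * y ^+ 2 * (B + s^-1)) / s.
  by rewrite /x; field; rewrite gt_eqF.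
have : (2 * m%:R * y - e) / s <= (2 * m%:R * y - 2 * m%:R * y ^+ 2 * (B + s^-1)) / s.
  by rewrite ler_pM2r //; lra.
move=> h1 h2 h3; lra.
Qed.

End rho_bounds.

(** * Estimates relative to the distance from 1 *)

(** The gap 1 - f(a) f(b) = 2(a+b)/((1+a)(1+b)) increases in each argument on [0,1], so replacing k
    by q h only enlarges it. The gain is a factor, not a summand, because the gap itself may be
    arbitrarily small. *)
Lemma cayley_lt_scale (R : realFieldType) (h1 h2 k1 k2 q : R) :
  0 < h1 <= 1 -> 0 < h2 <= 1 -> 0 <= k1 <= q * h1 -> 0 <= k2 <= q * h2 ->
  0 < q < 1 ->
  1 - cayley k1 * cayley k2 <=
    (1 - cayley h1 * cayley h2) * (1 - (1 - q) ^+ 2 / 4).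
Proof.
move=> /andP[h10 h11] /andP[h20 h21] /andP[k10 k11] /andP[k20 k21] /andP[q0 q1].
have phi (a b : R) : 0 <= a -> 0 <= b ->
    1 - cayley a * cayley b = 2 * (a + b) / ((1 + a) * (1 + b)).
  by move=> a0 b0; rewrite /cayley; field; apply/andP; split; rewrite gt_eqF //; lra.
have qh1 : 0 <= q * h1 by rewrite mulr_ge0 // ltW.
have qh2 : 0 <= q * h2 by rewrite mulr_ge0 // ltW.
have qh11 : q * h1 < 1 by nra.
have qh21 : q * h2 < 1 by nra.
have mono (a b a' : R) : 0 <= a -> a <= a' -> 0 <= b <= 1 ->
    2 * (a + b) / ((1 + a) * (1 + b)) <= 2 * (a' + b) / ((1 + a') * (1 + b)).
  move=> a0 aa /andP[b0 b1].
  have P1 : 0 < (1 + a) * (1 + b) by rewrite mulr_gt0; lra.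
  have P2 : 0 < (1 + a') * (1 + b) by rewrite mulr_gt0; lra.
  rewrite ler_pdivrMr // mulrAC ler_pdivlMr //.
  rewrite -subr_ge0.
  have -> : 2 * (a' + b) * ((1 + a) * (1 + b)) - 2 * (a + b) * ((1 + a') * (1 + b))
     = 2 * (1 + b) * ((a' - a) * (1 - b)) by ring.
  by rewrite mulr_ge0 ?mulr_ge0 // ?subr_ge0 //; lra.
have monoC (a b : R) : 2 * (a + b) / ((1 + a) * (1 + b)) =
    2 * (b + a) / ((1 + b) * (1 + a)) by rewrite addrC [_ * (1 + b)]mulrC.
rewrite !phi ?(ltW h10) ?(ltW h20) //.
apply: (@le_trans _ _ (2 * (q * h1 + q * h2) / ((1 + q * h1) * (1 + q * h2)))).
  apply: (@le_trans _ _ (2 * (q * h1 + k2) / ((1 + q * h1) * (1 + k2)))).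
    by apply: mono => //; rewrite k20 //=; lra.
  by rewrite monoC [leRHS]monoC; apply: mono => //; rewrite qh1 ltW.
have P1 : 0 < (1 + q * h1) * (1 + q * h2) by rewrite mulr_gt0; lra.
have P2 : 0 < (1 + h1) * (1 + h2) by rewrite mulr_gt0; lra.
(* The difference (1+q h1)(1+q h2) - q(1+h1)(1+h2) = (1-q)(1-q h1 h2) is at least (1-q)^2, and (1+q
   h1)(1+q h2) <= 4. *)
have key : q * ((1 + h1) * (1 + h2)) <=
    (1 - (1 - q) ^+ 2 / 4) * ((1 + q * h1) * (1 + q * h2)).
  have P3 : (1 + q * h1) * (1 + q * h2) <= 2 * 2.
    by apply: ler_pM; lra.
  have P4 : (1 - q) ^+ 2 / 4 * ((1 + q * h1) * (1 + q * h2)) <= (1 - q) ^+ 2.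
    rewrite -mulrA ger_pMr ?exprn_gt0 ?subr_gt0 //.
    by rewrite mulrC ler_pdivrMr //; lra.
  have P5 : (1 + q * h1) * (1 + q * h2) - q * ((1 + h1) * (1 + h2)) =
      (1 - q) * (1 - q * h1 * h2) by ring.
  have P6 : (1 - q) ^+ 2 <= (1 - q) * (1 - q * h1 * h2).
    rewrite expr2 ler_wpM2l ?subr_ge0 ?(ltW q1) // lerB // -mulrA.
    by rewrite ger_pMr // mulr_ile1 // ltW.
  lra.
have hh : 0 <= 2 * (h1 + h2) by lra.
rewrite ler_pdivrMr // [X in _ <= X * _]mulrAC [leRHS]mulrAC ler_pdivlMr //.
have -> : 2 * (q * h1 + q * h2) * ((1 + h1) * (1 + h2)) =
  2 * (h1 + h2) * (q * ((1 + h1) * (1 + h2))) by ring.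
have -> : 2 * (h1 + h2) * (1 - (1 - q) ^+ 2 / 4) * ((1 + q * h1) * (1 + q * h2)) =
  2 * (h1 + h2) * ((1 - (1 - q) ^+ 2 / 4) * ((1 + q * h1) * (1 + q * h2))) by ring.
exact: ler_wpM2l.
Qed.

(** K is the value of G at y = 0, with a = 2-c and b = 2+c in the application. G^4 - K^4 is at most
    8 u y^2 / a^3, and its factor u is paid for by u a <= 16(1-K). Dividing by (G+K)(G^2+K^2) >=
    d^4/2^8 gives the constant 2^15 = 8 * 16 * 2^8. *)
Lemma ratio_perturbation (R : realFieldType) (a b u y d K G : R) :
  0 < d -> 0 < u <= a - d -> a <= 2 -> a <= b -> b + u <= 4 -> 0 < K -> 0 <= G ->
  K ^+ 4 * ((a + u) ^+ 2 * (b + u) ^+ 2) = (a - u) ^+ 2 * (b - u) ^+ 2 ->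
  G ^+ 4 * (((a + u) ^+ 2 + y ^+ 2) * ((b + u) ^+ 2 + y ^+ 2)) =
    ((a - u) ^+ 2 + y ^+ 2) * ((b - u) ^+ 2 + y ^+ 2) ->
  G - K <= 2 ^+ 15 / (a ^+ 4 * d ^+ 4) * y ^+ 2 * (1 - K).
Proof.
move=> d0 /andP[u0 ud] a2 ab bu K0 G0 KE GE.
have a0 : 0 < a by lra.
have b0 : 0 < b by lra.
have Y0 : 0 <= y ^+ 2 by exact: sqr_ge0.
pose k v := (v - u) ^+ 2 / (v + u) ^+ 2.
pose g v := ((v - u) ^+ 2 + y ^+ 2) / ((v + u) ^+ 2 + y ^+ 2).
have sq0 v : 0 < v -> 0 < (v + u) ^+ 2 by move=> v0; apply: exprn_gt0; lra.
have sqy0 v : 0 < v -> 0 < (v + u) ^+ 2 + y ^+ 2 by move=> /sq0; lra.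
have K4 : K ^+ 4 = k a * k b.
  have [? ?] := (sq0 a a0, sq0 b b0).
  by rewrite /k mulf_div -KE mulfK // mulf_neq0 // gt_eqF.
have G4 : G ^+ 4 = g a * g b.
  have [? ?] := (sqy0 a a0, sqy0 b b0).
  by rewrite /g mulf_div -GE mulfK // mulf_neq0 // gt_eqF.
have k0 v : 0 < v -> 0 <= k v by move=> v0; rewrite divr_ge0 ?sqr_ge0.
have k1 v : 0 < v -> k v = 1 - 4 * v * u / (v + u) ^+ 2.
  by move=> v0; rewrite /k; field; rewrite gt_eqF //; lra.
have kle1 v : 0 < v -> k v <= 1.
  move=> v0; rewrite k1 // gerBl divr_ge0 ?sqr_ge0 //.
  by rewrite !mulr_ge0 // ltW.
have gle1 v : 0 < v -> g v <= 1.
  move=> v0; rewrite /g ler_pdivrMr ?sqy0 // mul1r lerD2r.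
  have -> : (v + u) ^+ 2 = (v - u) ^+ 2 + 4 * (v * u) by ring.
  by rewrite lerDl !mulr_ge0 // ltW.
have gk v : a <= v -> g v - k v <= 4 * u * y ^+ 2 / a ^+ 3.
  move=> av; have v0 : 0 < v by lra.
  have [p1 p2] := (sq0 v v0, sqy0 v v0).
  have -> : g v - k v = 4 * u * y ^+ 2 * (v / ((v + u) ^+ 2 * ((v + u) ^+ 2 + y ^+ 2))).
    by rewrite /g /k; field; rewrite !gt_eqF //; lra.
  apply: ler_wpM2l; first by rewrite mulr_ge0 // mulr_ge0 // ltW.
  rewrite (ler_pdivrMr _ _ (mulr_gt0 p1 p2)) mulrC ler_pdivlMr ?exprn_gt0 //.
  have q1 : v * a <= (v + u) ^+ 2 by nra.
  have q2 : a ^+ 2 <= (v + u) ^+ 2 + y ^+ 2 by nra.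
  have -> : v * a ^+ 3 = (v * a) * a ^+ 2 by ring.
  by apply: ler_pM; rewrite ?mulr_ge0 ?sqr_ge0 // ltW.
have diff : G ^+ 4 - K ^+ 4 <= 8 * u * y ^+ 2 / a ^+ 3.
  rewrite G4 K4.
  have -> : g a * g b - k a * k b = (g a - k a) * g b + k a * (g b - k b) by ring.
  have := gk a (lexx a); have := gk b ab.
  have t0 : 0 <= 4 * u * y ^+ 2 / a ^+ 3.
    by apply: divr_ge0; [rewrite mulr_ge0 // mulr_ge0 // ltW|rewrite exprn_ge0 // ltW].
  set t := 4 * u * y ^+ 2 / a ^+ 3 in t0 * => h1 h2.
  have g0 : 0 <= g b by rewrite divr_ge0 ?addr_ge0 ?sqr_ge0.
  have -> : 8 * u * y ^+ 2 / a ^+ 3 = t + t by rewrite /t; field; rewrite gt_eqF.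
  apply: lerD.
    apply: (@le_trans _ _ (t * g b)); first exact: ler_wpM2r.
    by rewrite -[leRHS]mulr1 ler_wpM2l // gle1.
  apply: (@le_trans _ _ (k a * t)); first by rewrite ler_wpM2l // k0.
  by rewrite -[leRHS]mul1r ler_wpM2r // kle1.
have K41 : K ^+ 4 <= 1 - a * u / 4.
  rewrite K4; apply: (@le_trans _ _ (k a)).
    by rewrite -[leRHS]mulr1 ler_wpM2l ?k0 ?kle1.
  rewrite k1 // lerB // ler_pdivrMr // mulrAC ler_pdivlMr ?sq0 //.
  have : (a + u) ^+ 2 <= 4 ^+ 2 by rewrite ler_pXn2r ?nnegrE //; lra.
  have : 0 < a * u by exact: mulr_gt0.
  nra.
have Klt1 : K < 1.
  rewrite ltNge; apply/negP => h.
  have := exprn_ege1 4 h; have : 0 < a * u by exact: mulr_gt0.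
  lra.
have K1 : u * a <= 16 * (1 - K).
  have : 1 - K ^+ 4 <= 4 * (1 - K).
    have -> : 1 - K ^+ 4 = (1 - K) * (1 + K + K ^+ 2 + K ^+ 3) by ring.
    rewrite mulrC ler_wpM2r ?subr_ge0 ?(ltW Klt1) //.
    have : K ^+ 2 <= 1 by rewrite exprn_ile1 // ltW.
    have : K ^+ 3 <= 1 by rewrite exprn_ile1 // ltW.
    lra.
  lra.
have p0 : d ^+ 4 / 2 ^+ 8 <= K ^+ 4.
  rewrite ler_pdivrMr ?exprn_gt0 //.
  have e1 : d ^+ 2 * d ^+ 2 <= (a - u) ^+ 2 * (b - u) ^+ 2.
    by apply: ler_pM; rewrite ?sqr_ge0 // ler_pXn2r ?nnegrE //; lra.
  have e2 : (a + u) ^+ 2 * (b + u) ^+ 2 <= 4 ^+ 2 * 4 ^+ 2.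
    by apply: ler_pM; rewrite ?sqr_ge0 // ler_pXn2r ?nnegrE //; lra.
  rewrite -KE in e1.
  have : K ^+ 4 * ((a + u) ^+ 2 * (b + u) ^+ 2) <= K ^+ 4 * (4 ^+ 2 * 4 ^+ 2).
    by rewrite ler_wpM2l // exprn_ge0 // ltW.
  rewrite (_ : d ^+ 4 = d ^+ 2 * d ^+ 2); [lra|ring].
have RHS0 : 0 <= 2 ^+ 15 / (a ^+ 4 * d ^+ 4) * y ^+ 2 * (1 - K).
  apply: mulr_ge0; last by rewrite subr_ge0 ltW.
  apply: mulr_ge0 => //; apply: divr_ge0; first exact: exprn_ge0.
  by apply: mulr_ge0; apply: exprn_ge0; apply: ltW.
have [GK|KG] := leP G K; first by lra.
have K3 : d ^+ 4 / 2 ^+ 8 <= (G + K) * (G ^+ 2 + K ^+ 2).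
  apply: (le_trans p0); apply: (@le_trans _ _ (K ^+ 3)).
    by rewrite exprS ger_pMl ?exprn_gt0 // ltW.
  have -> : K ^+ 3 = K * K ^+ 2 by ring.
  have : 0 <= G ^+ 2 by exact: sqr_ge0.
  by move=> ?; apply: ler_pM; [exact: ltW|exact: sqr_ge0|lra|lra].
have step : (G - K) * (d ^+ 4 / 2 ^+ 8) <= 8 * u * y ^+ 2 / a ^+ 3.
  apply: le_trans diff.
  have -> : G ^+ 4 - K ^+ 4 = (G - K) * ((G + K) * (G ^+ 2 + K ^+ 2)) by ring.
  by rewrite ler_wpM2l // subr_ge0 ltW.
have d4 : 0 < d ^+ 4 / 2 ^+ 8 by rewrite divr_gt0 ?exprn_gt0.
rewrite -(ler_pM2r d4); apply: (le_trans step).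
have -> : 2 ^+ 15 / (a ^+ 4 * d ^+ 4) * y ^+ 2 * (1 - K) * (d ^+ 4 / 2 ^+ 8) =
   8 * (16 * (1 - K)) * y ^+ 2 / a ^+ 4.
  by field; rewrite !gt_eqF.
have -> : 8 * u * y ^+ 2 / a ^+ 3 = 8 * (u * a) * y ^+ 2 / a ^+ 4.
  by field; rewrite !gt_eqF.
rewrite ler_pM2r ?invr_gt0 ?exprn_gt0 // ler_wpM2r // ler_pM2l //.
Qed.

(** * Half-angle tangents and the inverse of X *)

Lemma tanh_cayley (R : realType) (x : R) :
  Defs.tanh x = cayley (expR (- (x * 2))).
Proof.
rewrite /Defs.tanh /cayley; have := expR_gt0 x; have := expR_gt0 (- x).
rewrite (_ : - (x * 2) = - x + - x); last by ring.
rewrite expRD expRN => h1 h0.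
have e2 : expR x ^+ 2 + 1 != 0 by rewrite gt_eqF // addr_gt0 // exprn_gt0.
by field; rewrite gt_eqF //= -expr2.
Qed.

Lemma X_cayley (R : realType) (c u v : R) :
  Defs.X c u v = cayley (expR (- (v / Num.sqrt (4 - (u - c) ^+ 2)))) *
                 cayley (expR (- (v / Num.sqrt (4 - (u + c) ^+ 2)))).
Proof.
rewrite /Defs.X !tanh_cayley; congr (cayley (expR (- _)) * cayley (expR (- _)));
by rewrite invfM mulrCA mulrAC mulVf ?mul1r ?pnatr_eq0.
Qed.

Lemma tan_half_acos (R : realType) (x : R) : -1 < x < 1 ->
  0 < tan (acos x / 2) /\ tan (acos x / 2) ^+ 2 = (1 - x) / (1 + x).
Proof.
move=> /andP[x1 x2].
have xx : -1 <= x <= 1 by rewrite !ltW.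
have a0 : 0 < acos x by apply: acos_gt0; rewrite x2 ltW.
have ap : acos x < pi by apply: acos_ltpi; rewrite x1 ltW.
have cE : cos (acos x) = x by apply: acosK; rewrite in_itv /=.
set t := acos x / 2.
have tE : acos x = t *+ 2 by rewrite /t -mulr_natr divfK.
have tp : 0 < t < pi / 2 by rewrite /t divr_gt0 //= ltr_pM2r // invr_gt0.
have s0 : 0 < sin t by exact: sin_gt0_pihalf.
have c0 : 0 < cos t.
  by case/andP: tp => ? ?; apply: cos_gt0_pihalf; apply/andP; split; lra.
have c2 : cos t ^+ 2 = (1 + x) / 2 by move: cE; rewrite tE cos_mulr2n; lra.
have s2 : sin t ^+ 2 = (1 - x) / 2 by rewrite sin2cos2 c2; field.
split; first by rewrite /tan divr_gt0.
rewrite /tan expr_div_n c2 s2; field; rewrite gt_eqF //; lra.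
Qed.

(** The K of the overview: the point at which [Lambda] inverts X. *)
Definition tan_prod (R : realType) (c u : R) : R :=
  tan (acos ((u - c) / 2) / 2) * tan (acos ((u + c) / 2) / 2).

Section Lambda_properties.
Variables (R : realType) (c u : R).
Hypothesis c02 : 0 < c < 2.
Hypothesis u02 : 0 < u < 2 - c.

Let K := tan_prod c u.

(** By tan^2(t/2) = (1 - cos t)/(1 + cos t), K satisfies the equation of G^4 with y = 0, which makes
    the two comparable. *)
Lemma tan_prodE : 0 < K /\
  K ^+ 4 * ((2 - c + u) ^+ 2 * (2 + c + u) ^+ 2) =
    (2 - c - u) ^+ 2 * (2 + c - u) ^+ 2.
Proof.
have [/andP[c0 c2] /andP[u0 u2]] := (c02, u02).
have [|p1 e1] := @tan_half_acos _ ((u - c) / 2).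
  by apply/andP; split; lra.
have [|p2 e2] := @tan_half_acos _ ((u + c) / 2).
  by apply/andP; split; lra.
split; first exact: mulr_gt0.
rewrite /K /tan_prod.
have pow4 (x y : R) : (x * y) ^+ 4 = (x ^+ 2) ^+ 2 * (y ^+ 2) ^+ 2 by ring.
rewrite pow4.
rewrite e1 e2; field; apply/andP; split; rewrite gt_eqF //; lra.
Qed.

Lemma tan_prod_lt1 : K < 1.
Proof.
have [/andP[c0 c2] /andP[u0 u2]] := (c02, u02).
have [K0 KE] := tan_prodE.
rewrite ltNge; apply/negP => K1.
have e1 : (2 - c - u) ^+ 2 < (2 - c + u) ^+ 2.
  by rewrite ltr_pXn2r ?nnegrE //; lra.
have e2 : (2 + c - u) ^+ 2 < (2 + c + u) ^+ 2.
  by rewrite ltr_pXn2r ?nnegrE //; lra.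
have := ltr_pM (sqr_ge0 _) (sqr_ge0 _) e1 e2; rewrite -KE.
have P : 0 < (2 - c + u) ^+ 2 * (2 + c + u) ^+ 2 by apply: mulr_gt0; apply: exprn_gt0; lra.
by rewrite gtr_pMl // ltNge exprn_ege1.
Qed.

Let s1 := Num.sqrt (4 - (u - c) ^+ 2).
Let s2 := Num.sqrt (4 - (u + c) ^+ 2).

Lemma sqrt_bounds : [/\ 0 < s1, s1 <= 2, 0 < s2 & s2 <= 2].
Proof.
have [/andP[c0 c2] /andP[u0 u2]] := (c02, u02).
have h1 : 0 < 4 - (u - c) ^+ 2 by nra.
have h2 : 0 < 4 - (u + c) ^+ 2 by nra.
have le2 x : 0 < 4 - x ^+ 2 -> Num.sqrt (4 - x ^+ 2) <= 2.
  move=> x0; rewrite -(@ler_pXn2r _ 2%N) ?nnegrE ?sqrtr_ge0 // sqr_sqrtr ?(ltW x0) //.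
  have := sqr_ge0 x; lra.
by split; rewrite ?sqrtr_gt0 // le2.
Qed.

Lemma X_continuous : continuous (Defs.X c u).
Proof.
have -> : Defs.X c u = fun v => cayley (expR (- (v / s1))) * cayley (expR (- (v / s2))).
  by apply/funext => v; rewrite X_cayley.
have cay s : continuous (fun v : R => cayley (expR (- (v / s)))).
  move=> v; rewrite /cayley.
  have ce : (fun v : R => expR (- (v / s))) @ v --> expR (- (v / s)).
    apply: continuous_comp; last exact: continuous_expR.
    by apply: cvgN; apply: cvgM; [exact: cvg_id|exact: cvg_cst].
  apply: cvgM.
    by apply: cvgB => //; exact: cvg_cst.
  apply: cvgV; first by rewrite gt_eqF // addr_gt0 // expR_gt0.
  by apply: cvgD => //; exact: cvg_cst.
by move=> v; apply: cvgM; exact: cay.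
Qed.

(** The intermediate value theorem puts K in the image of ]0, +oo[, so ['pinv_] returns a true
    positive preimage and not its default 0. *)
Lemma LambdaP : 0 < Lambda c u /\ Defs.X c u (Lambda c u) = K.
Proof.
have [K0 _] := tan_prodE; have K1 := tan_prod_lt1.
have [s10 s12 s20 s22] := sqrt_bounds.
have [V V0 VK] : exists2 V : R, 0 <= V & K <= Defs.X c u V.
  (* Chosen so that h = exp(-V/2) <= (1-K)/4. Both square roots are at most 2, hence X(V) >=
     (1-2h)^2 >= 1-4h >= K. *)
  pose V := 8 / (1 - K); have V0 : 0 < V by rewrite divr_gt0 // subr_gt0.
  exists V; first exact: ltW.
  pose h := expR (- (V / 2)).
  have h1 : h <= (1 - K) / 4.
    have e1 := expR_ge1Dx (V / 2).
    have P : 0 < (1 - K) / 4 by rewrite divr_gt0 // subr_gt0.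
    have PV : ((1 - K) / 4)^-1 = V / 2.
      by rewrite /V; field; rewrite gt_eqF // subr_gt0.
    rewrite /h expRN -[leRHS]invrK lef_pV2 ?posrE ?expR_gt0 ?invr_gt0 // PV.
    lra.
  have h0 : 0 < h by exact: expR_gt0.
  have cay s : 0 < s <= 2 -> 1 - 2 * h <= cayley (expR (- (V / s))).
    move=> /andP[s0 s2'].
    have : expR (- (V / s)) <= h.
      by rewrite ler_expR lerN2 ler_pM2l // lef_pV2 ?posrE.
    have := expR_gt0 (- (V / s)); set k := expR _ => k0 kh.
    rewrite /cayley ler_pdivlMr; last by rewrite addr_gt0.
    nra.
  rewrite X_cayley -/s1 -/s2.
  apply: (@le_trans _ _ ((1 - 2 * h) * (1 - 2 * h))); first by nra.
  have hh : 0 <= 1 - 2 * h by lra.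
  by apply: ler_pM => //; apply: cay; rewrite ?s10 ?s20.
have X0 : Defs.X c u 0 = 0.
  by rewrite /Defs.X /Defs.tanh !mul0r oppr0 subrr mul0r mul0r.
have [x /andP[] ] : exists2 x, x \in `[0, V]%R & Defs.X c u x = K.
  apply: IVT => //; first exact/continuous_subspaceT/X_continuous.
  rewrite X0 ge_min le_max (ltW K0) VK orbT //.
rewrite !bnd_simp => x0 xV xK.
have x0' : 0 < x.
  rewrite lt_def x0 andbT; apply/eqP => e.
  by move: K0; rewrite -xK e X0 ltxx.
have im : K \in [set Defs.X c u y | y in `]0, +oo[%classic].
  by apply/mem_set; exists x => //=; rewrite in_itv /= x0'.
have LE : Lambda c u = 'pinv_(fun=> 0) `]0, +oo[%classic (Defs.X c u) K by [].
have XL : Defs.X c u (Lambda c u) = K.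
  by rewrite LE pinvK.
split=> //.
have surj : set_surj `]0, +oo[%classic [set K] (Defs.X c u).
  by move=> _ ->; exists x => //=; rewrite in_itv /= x0'.
have := surjpinv_image_sub (dflt := fun=> 0) surj.
move=> /(_ (Lambda c u)); rewrite /= in_itv /= andbT; apply.
by exists K.
Qed.

End Lambda_properties.

(** * Uniform bounds on the imaginary part *)

(** With x = m y / 2 and exp(x) >= x^3/6, the hypothesis gives m^3 y^4 <= 2^11 * 48, that is (m
    y^2)^2 = O(1/m). *)
Lemma im_bound_a_priori (R : realType) (eta : R) : 0 < eta ->
  exists M : nat, forall (m : nat) (y : R), (M <= m)%N -> 0 < y ->
    y <= 2 ^+ 11 * expR (- (m%:R * y / 2)) ->
    [/\ (0 < m)%N, m%:R * y ^+ 2 <= eta & y ^+ 2 <= eta].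
Proof.
move=> eta0.
pose D : R := 2 ^+ 11 * 48.
pose M := (Num.truncn (D / eta ^+ 2)).+1.
exists M => m y Mm y0 hy.
have m0 : (0 < m)%N by exact: leq_ltn_trans Mm.
have m1 : 1 <= m%:R :> R by rewrite ler1n.
have M1 : D / eta ^+ 2 < m%:R.
  by apply: lt_le_trans (truncnS_gt _) _; rewrite ler_nat.
have m0' : 0 < m%:R :> R by rewrite ltr0n.
set x := m%:R * y / 2 in hy.
have x0 : 0 <= x by rewrite /x divr_ge0 // mulr_ge0 // ltW.
have ex : x ^+ 3 / 6 <= expR x.
  by have := @expR_ge1Dxn _ _ 2 x0; rewrite (_ : 3`!%N = 6%N) //; lra.
have yx : y * expR x <= 2 ^+ 11.
  have := ler_wpM2r (expR_ge0 x) hy.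
  by rewrite -mulrA -expRD addNr expR0 mulr1.
have h1 : y * (x ^+ 3 / 6) <= 2 ^+ 11.
  by apply: le_trans yx; rewrite ler_pM2l.
have h2 : (m%:R * y ^+ 2) ^+ 2 * m%:R <= D.
  have -> : (m%:R * y ^+ 2) ^+ 2 * m%:R = 48 * (y * (x ^+ 3 / 6)) by rewrite /x; field.
  by rewrite /D mulrC ler_pM2r.
have main : m%:R * y ^+ 2 <= eta.
  rewrite leNgt; apply/negP => h.
  move: M1; rewrite ltr_pdivrMr ?exprn_gt0 // ltNge => /negP; apply.
  apply: le_trans h2; rewrite mulrC ler_pM2r //.
  by apply: lerXn2r; rewrite ?nnegrE ?ltW // (lt_trans eta0).
split=> //; apply: le_trans main.
by rewrite -[leLHS]mul1r ler_wpM2r // sqr_ge0.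
Qed.

(** If r, s <= q, the inequality forces G >= T^2 with T = f(q). But (2-c-u)^2 and y^2 are both at
    most (2-c)^2 T^8 / 4, which makes G^4 smaller than T^8. *)
Lemma im_bound_near_edge (R : realType) (c u y G q r s : R) :
  0 < c < 2 -> 0 < u < 2 - c ->
  0 < q < 1 -> 0 < r <= q -> 0 < s <= q ->
  2 - c - (2 - c) / 2 * cayley q ^+ 4 <= u ->
  y ^+ 2 <= (2 - c) ^+ 2 / 4 * cayley q ^+ 8 ->
  0 <= G ->
  G ^+ 4 * (((2 - c + u) ^+ 2 + y ^+ 2) * ((2 + c + u) ^+ 2 + y ^+ 2)) =
    ((2 - c - u) ^+ 2 + y ^+ 2) * ((2 + c - u) ^+ 2 + y ^+ 2) ->
  ~ (1 - r) * (1 - s) <= G * ((1 + r) * (1 + s)).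
Proof.
move=> /andP[c0 c2] /andP[u0 u2] /andP[q0 q1] /andP[r0 rq] /andP[s0 sq] ud yq G0 GE hG.
set T := cayley q in ud yq.
have T0 : 0 < T by rewrite /T /cayley divr_gt0 //; lra.
have cayq k : 0 < k -> k <= q -> T <= (1 - k) / (1 + k).
  move=> k0 kq; rewrite /T /cayley ler_pdivrMr; last lra.
  rewrite mulrAC ler_pdivlMr; last lra.
  nra.
have TG : T ^+ 2 <= G.
  have P : 0 < (1 + r) * (1 + s) by rewrite mulr_gt0; lra.
  rewrite -(ler_pM2r P); apply: le_trans hG; rewrite expr2.
  apply: (@le_trans _ _ ((1 - r) / (1 + r) * ((1 - s) / (1 + s)) * ((1 + r) * (1 + s)))).
    rewrite ler_pM2r //; apply: ler_pM; rewrite ?(ltW T0) // cayq //.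
  rewrite le_eqVlt; apply/orP; left; apply/eqP; field.
  by apply/andP; split; rewrite gt_eqF //; lra.
have TG4 : T ^+ 8 <= G ^+ 4.
  rewrite (_ : T ^+ 8 = (T ^+ 2) ^+ 4); last by rewrite -exprM.
  by apply: lerXn2r; rewrite ?nnegrE ?exprn_ge0 // ltW.
have y2 : 0 <= y ^+ 2 by exact: sqr_ge0.
have Gle : G ^+ 4 * ((2 - c + u) ^+ 2 + y ^+ 2) <= (2 - c - u) ^+ 2 + y ^+ 2.
  have P : 0 < (2 + c + u) ^+ 2 + y ^+ 2.
    by apply: ltr_wpDr => //; apply: exprn_gt0; lra.
  rewrite -(ler_pM2r P) -mulrA GE; apply: ler_wpM2l.
    by rewrite addr_ge0 // sqr_ge0.
  rewrite lerD2r; apply: lerXn2r; rewrite ?nnegrE; lra.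
have du : (2 - c - u) ^+ 2 <= ((2 - c) / 2 * T ^+ 4) ^+ 2.
  apply: lerXn2r; rewrite ?nnegrE; [lra| |lra].
  by rewrite mulr_ge0 ?exprn_ge0 //; [lra|exact: ltW].
have dE : ((2 - c) / 2 * T ^+ 4) ^+ 2 = (2 - c) ^+ 2 / 4 * T ^+ 8 by field.
have T8 : 0 < T ^+ 8 by exact: exprn_gt0.
have low : T ^+ 8 * (2 - c) ^+ 2 <= G ^+ 4 * ((2 - c + u) ^+ 2 + y ^+ 2).
  have : 0 <= u * (2 * (2 - c) + u) by rewrite mulr_ge0; lra.
  by move=> ?; apply: ler_pM; [exact: ltW|exact: sqr_ge0|exact: TG4|lra].
have pos : 0 < T ^+ 8 * (2 - c) ^+ 2 by rewrite mulr_gt0 // exprn_gt0 //; lra.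
lra.
Qed.

(** Suppose 2 m |y| > Lambda + eps. Near the edge the previous lemma applies. Elsewhere the sharp
    bounds improve both exponentials by the factor q, so G >= K + kappa (1-K), whereas the
    perturbation estimate gives G <= K + (kappa/2)(1-K). All constants depend on c and eps only. *)
Lemma im_bound (R : realType) (c eps : R) : 0 < c < 2 -> 0 < eps ->
  exists M : nat, forall (m : nat) (lambda : R[i]), (M <= m)%N ->
    tridiag_sol (c%:C - lambda) m * tridiag_sol (c%:C + lambda) m =
    tridiag_sol (c%:C - lambda) m.+1 * tridiag_sol (c%:C + lambda) m.+1 ->
    0 < complex.Re lambda < 2 - c ->
    2 * m%:R * `|complex.Im lambda| <= Lambda c (complex.Re lambda) + eps.
Proof.
move=> c02 eps0; have /andP[c0 c2] := c02.
(* Half of eps covers the second-order loss; the other half, divided by a square root that is at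
   most 2, leaves eps/4 in the exponent. *)
pose q := expR (- (eps / 4)).
have q0 : 0 < q by exact: expR_gt0.
have q1 : q < 1 by rewrite /q -[ltRHS]expR0 ltr_expR oppr_lt0 divr_gt0.
pose T := cayley q.
have T0 : 0 < T by rewrite /T /cayley divr_gt0 //; lra.
pose a := 2 - c; have a0 : 0 < a by rewrite subr_gt0.
pose d := a / 2 * T ^+ 4.
have d0 : 0 < d by rewrite mulr_gt0 ?exprn_gt0 // divr_gt0.
pose kappa := (1 - q) ^+ 2 / 4.
have kappa0 : 0 < kappa by rewrite divr_gt0 // exprn_gt0 // subr_gt0.
pose C := 2 ^+ 15 / (a ^+ 4 * d ^+ 4).
have C0 : 0 < C.
  by apply: divr_gt0; [exact: exprn_gt0|apply: mulr_gt0; exact: exprn_gt0].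
(* A lower bound for 4 - (u+c)^2 and 4 - (u-c)^2 over all u <= a - d. *)
pose sg := Num.min (2 * d) (2 * c * a).
have sg0 : 0 < sg.
  by rewrite lt_min; apply/andP; split; apply: mulr_gt0 => //; exact: mulr_gt0.
pose B := 4 / sg ^+ 2.
have B0 : 0 < B by rewrite /B divr_gt0 // exprn_gt0.
have E0 : 0 < B + 2 / sg by rewrite addr_gt0 // divr_gt0.
(* The four entries ensure, in order: y <= 1, the edge hypothesis on y^2, a second-order loss of at
   most eps/2, and C y^2 <= kappa/2. *)
pose eta := Num.min (Num.min 1 (a ^+ 2 / 4 * T ^+ 8))
  (Num.min (eps / 4 / (B + 2 / sg)) (kappa / (2 * C))).
have eta0 : 0 < eta.
  have aT : 0 < a ^+ 2 / 4 * T ^+ 8.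
    by apply: mulr_gt0; [apply: divr_gt0 => //|]; exact: exprn_gt0.
  have ee : 0 < eps / 4 / (B + 2 / sg) by apply: divr_gt0 => //; exact: divr_gt0.
  have kC : 0 < kappa / (2 * C) by apply: divr_gt0 => //; exact: mulr_gt0.
  by rewrite !lt_min ltr01 aT ee kC.
have [M HM] := im_bound_a_priori eta0.
exists M => m lambda Mm rec u02.
set u := complex.Re lambda in u02 *; have /andP[u0 u2] := u02.
have [L0 LK] := LambdaP c02 u02.
have [y0|y0] := eqVneq (complex.Im lambda) 0.
  by rewrite y0 normr0 mulr0 addr_ge0 ?ltW.
have [r1 [r2 [G]]] := eigenvalue_constraints c02 rec y0.
rewrite /= -/u; set n := (m + m).+1.
rewrite -(real_normK (num_real (complex.Im lambda))).
set y := `|complex.Im lambda|.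
case=> -[r1b r2b] [r1E r2E] [G0 GE] hG [y2 yrs].
have y0' : 0 < y by rewrite /y normr_gt0.
have y02 : 0 <= y <= 2 by rewrite ltW.
have cr1 := rho_exp_le_crude r1b r1E m y02.
have cr2 := rho_exp_le_crude r2b r2E m y02.
have ye : y <= 2 ^+ 11 * expR (- (m%:R * y / 2)).
  apply: (le_trans yrs); rewrite -/n in cr1 cr2.
  by move: cr1 cr2; set E := expR _; clear; lra.
have [m0 my yeta] := HM m y Mm y0' ye.
have [eta1 eta2 eta3 eta4] : [/\ eta <= 1, eta <= a ^+ 2 / 4 * T ^+ 8,
    eta <= eps / 4 / (B + 2 / sg) & eta <= kappa / (2 * C)].
  by rewrite /eta !ge_min !lexx !orbT.
have r1n : 0 < r1 ^+ n < 1.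
  case/andP: r1b => b1 b2; rewrite exprn_gt0 //=.
  by apply: exprn_ilt1 => //; exact: ltW.
have r2n : 0 < r2 ^+ n < 1.
  case/andP: r2b => b1 b2; rewrite exprn_gt0 //=.
  by apply: exprn_ilt1 => //; exact: ltW.
have /andP[r1n0 r1n1] := r1n; have /andP[r2n0 r2n1] := r2n.
rewrite leNgt; apply/negP => hv.
have expq : expR (- (m%:R * y / 2)) <= q by rewrite /q ler_expR; move: hv; clear - L0; lra.
have [ud|ud] := leP (a - d) u.
  apply: (im_bound_near_edge (q := q) c02 u02 _ _ _ ud _ G0 GE hG).
  - by rewrite q0.
  - by rewrite r1n0 (le_trans cr1).
  - by rewrite r2n0 (le_trans cr2).
  - exact: le_trans yeta eta2.
have y1 : 0 < y <= 1.
  rewrite y0' /= -(@ler_pXn2r _ 2%N) ?nnegrE ?(ltW y0') // expr1n.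
  exact: le_trans yeta eta1.
have [s10 s12 s20 s22] := sqrt_bounds c02 u02.
have s1E : Num.sqrt (4 - (u - c) ^+ 2) ^+ 2 = 4 - (c - u) ^+ 2.
  rewrite sqr_sqrtr; first by ring.
  by rewrite ltW // -sqrtr_gt0.
have s2E : Num.sqrt (4 - (u + c) ^+ 2) ^+ 2 = 4 - (c + u) ^+ 2.
  rewrite sqr_sqrtr; first by ring.
  by rewrite ltW // -sqrtr_gt0.
have sg1 : sg <= 4 - (c - u) ^+ 2.
  apply: (@le_trans _ _ (2 * c * a)); first by rewrite /sg ge_min lexx orbT.
  rewrite /a in u2 *.
  have : 0 <= (2 - c - u) * (2 - c + u).
    by move: u0 u2 c0; clear => *; apply: mulr_ge0; lra.
  have : 0 <= c * u by rewrite mulr_ge0 // ltW.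
  by clear; lra.
have sg2 : sg <= 4 - (c + u) ^+ 2.
  apply: (@le_trans _ _ (2 * d)); first by rewrite /sg ge_min lexx.
  have -> : 4 - (c + u) ^+ 2 = (2 + (c + u)) * (a - u) by rewrite /a; ring.
  apply: ler_pM; [by []|exact: ltW|by rewrite lerDl addr_ge0 // ltW|].
  by move: ud; clear; lra.
have hy2 : 2 * m%:R * y ^+ 2 * (B + 2 / sg) <= eps / 2.
  have := le_trans my eta3; rewrite ler_pdivlMr //; clear; lra.
have sharp rho A s : 0 < rho < 1 ->
    (forall S, S = (rho^-1 - rho) ^+ 2 ->
      A ^+ 2 * S + y ^+ 2 * (4 + S) = S * (4 + S)) ->
    0 < s -> s <= 2 -> s ^+ 2 = 4 - A ^+ 2 -> sg <= 4 - A ^+ 2 ->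
    rho ^+ n <= q * expR (- (Lambda c u / s)).
  move=> rhob rhoE s0 s2 sE sgA.
  have hB : 4 <= B * s ^+ 4.
    rewrite /B mulrAC ler_pdivlMr ?exprn_gt0 // ler_pM2l //.
    rewrite (_ : s ^+ 4 = (s ^+ 2) ^+ 2); last by rewrite -exprM.
    by apply: lerXn2r; rewrite ?nnegrE ?(ltW sg0) ?sqr_ge0 // sE.
  have hs : s^-1 <= 2 / sg.
    rewrite ler_pdivlMr // ler_pdivrMl //.
    rewrite -sE in sgA; apply: (le_trans sgA); rewrite expr2 ler_pM2l //.
  apply: le_trans (rho_exp_le_sharp (e := eps / 2) rhob rhoE s0 sE y1 hB _) _.
    apply: le_trans hy2; apply: ler_wpM2l; first by rewrite mulr_ge0 ?sqr_ge0 // mulr_ge0.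
    by rewrite lerD2l.
  rewrite -expRD ler_expR.
  have : (Lambda c u + eps / 2) / s <= (2 * m%:R * y - eps / 2) / s.
    by rewrite ler_pM2r ?invr_gt0 //; move: hv; clear; lra.
  have : eps / 4 <= eps / 2 / s.
    rewrite ler_pdivlMr //; have : eps * s <= eps * 2 by rewrite ler_pM2l.
    by clear; lra.
  by rewrite mulrDl; clear; lra.
have h1 := sharp r1 (c - u) _ r1b r1E s10 s12 s1E sg1.
have h2 := sharp r2 (c + u) _ r2b r2E s20 s22 s2E sg2.
set s1 := Num.sqrt (4 - (u - c) ^+ 2) in s10 h1.
set s2 := Num.sqrt (4 - (u + c) ^+ 2) in s20 h2.
have expL s : 0 < s -> 0 < expR (- (Lambda c u / s)) <= 1.
  by move=> s0; rewrite expR_gt0 -[X in _ <= X]expR0 ler_expR oppr_le0 divr_ge0 // ltW.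
have key : 1 - cayley (r1 ^+ n) * cayley (r2 ^+ n) <=
    (1 - cayley (expR (- (Lambda c u / s1))) * cayley (expR (- (Lambda c u / s2)))) *
    (1 - (1 - q) ^+ 2 / 4).
  apply: cayley_lt_scale; [exact: expL|exact: expL| | |by apply/andP].
    by apply/andP; split; [exact: ltW|exact: h1].
  by apply/andP; split; [exact: ltW|exact: h2].
rewrite -X_cayley LK -/kappa in key.
have cG : cayley (r1 ^+ n) * cayley (r2 ^+ n) <= G.
  have P : 0 < (1 + r1 ^+ n) * (1 + r2 ^+ n) by apply: mulr_gt0; exact: addr_gt0.
  by rewrite /cayley mulf_div (ler_pdivrMr _ _ P).
have [K0 KE] := tan_prodE c02 u02.
have K1 := tan_prod_lt1 c02 u02.
set K := tan_prod c u in key K0 KE K1.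
have pert : G - K <= C * y ^+ 2 * (1 - K).
  have [a2 ac cu] : [/\ a <= 2, a <= 2 + c & 2 + c + u <= 4].
    by rewrite /a; move: c0 u2; clear => *; split; lra.
  have uad : 0 < u <= a - d by rewrite u0 ltW.
  exact: ratio_perturbation a2 ac cu K0 G0 KE GE.
have Cy : C * y ^+ 2 <= kappa / 2.
  apply: (@le_trans _ _ (C * (kappa / (2 * C)))).
    by rewrite ler_pM2l // (le_trans yeta).
  rewrite le_eqVlt; apply/orP; left; apply/eqP; field.
  by rewrite gt_eqF.
have : C * y ^+ 2 * (1 - K) <= kappa / 2 * (1 - K).
  by rewrite ler_wpM2r // subr_ge0 ltW.
have : 0 < kappa * (1 - K) by rewrite mulr_gt0 // subr_gt0.
by move: pert key cG; clear; lra.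
Qed.

(** * Reduction to positive real part and the error term *)

(** The scalar equation is invariant under lambda -> -lambda, which exchanges c - lambda and c +
    lambda. *)
Lemma pencil_eigenvalue_normRe (R : realType) (m : nat) (c : R)
    (lambda : R[i]) :
  (0 < m)%N -> pencil_eigenvalue m c lambda ->
  exists mu : R[i], [/\ complex.Re mu = `|complex.Re lambda|,
    `|complex.Im mu| = `|complex.Im lambda| &
    tridiag_sol (c%:C - mu) m * tridiag_sol (c%:C + mu) m =
    tridiag_sol (c%:C - mu) m.+1 * tridiag_sol (c%:C + mu) m.+1].
Proof.
move=> m0 ev; have rec := pencil_eigenvalue_tridiag m0 ev.
have [re|re] := leP 0 (complex.Re lambda).
  by exists lambda; split=> //; rewrite ger0_norm.
exists (- lambda); split.
- by rewrite ltr0_norm //; case: (lambda).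
- by rewrite -[RHS]normrN; case: (lambda).
- by rewrite opprK mulrC rec mulrC.
Qed.

(** This makes the supremum that defines the error term finite. *)
Lemma norm_Im_le2 (R : realType) (m : nat) (c : R) (lambda : R[i]) :
  0 < c < 2 ->
  tridiag_sol (c%:C - lambda) m * tridiag_sol (c%:C + lambda) m =
  tridiag_sol (c%:C - lambda) m.+1 * tridiag_sol (c%:C + lambda) m.+1 ->
  `|complex.Im lambda| <= 2.
Proof.
move=> c02 rec; have [->|y0] := eqVneq (complex.Im lambda) 0.
  by rewrite normr0.
by have [? [? [? [_ _ _ _ []]]]] := eigenvalue_constraints c02 rec y0.
Qed.

Unset Implicit Arguments.

Theorem theorem5p4 (R : realType) (c : R) (hc : 0 < c < 2) :
  exists2 e : nat -> R, e =o_\oo (fun m : nat => m%:R^-1 : R) &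
    forall (m : nat) (lambda : R[i]), (0 < m)%N ->
      pencil_eigenvalue m c lambda ->
      0 < `|complex.Re lambda| < 2 - c ->
      `|complex.Im lambda|
        <= Lambda c `|complex.Re lambda| / (2 * m%:R) + e m.
Proof.
(* The error e m is the largest excess over the main term among all admissible eigenvalues.
   Adjoining 0 keeps the set nonempty and the supremum nonnegative. *)
pose bad (m : nat) (x : R) := exists lambda : R[i],
  [/\ pencil_eigenvalue m c lambda, 0 < `|complex.Re lambda| < 2 - c &
   x = `|complex.Im lambda| - Lambda c `|complex.Re lambda| / (2 * m%:R)].
pose E m : set R := [set x | (0 < m)%N /\ bad m x] `|` [set 0].
have E0 m : E m !=set0 by exists 0; right.
have Esup m : has_sup (E m).
  split=> //; exists 2 => x [[m0 [lambda [ev re ->]]]|->] //.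
  have [mu [remu <- rec]] := pencil_eigenvalue_normRe m0 ev.
  have [L0 _] := LambdaP hc re.
  rewrite lerBlDr; apply: le_trans (norm_Im_le2 hc rec) _.
  by rewrite lerDl divr_ge0 ?mulr_ge0 // ltW.
exists (fun m => sup (E m)); last first.
  move=> m lambda m0 ev re; rewrite -lerBlDl.
  by apply: sup_upper_bound => //; left; split=> //; exists lambda.
apply/eqoP => eps eps0.
(* The tolerance is 2 eps because the bound is divided by 2m afterwards. *)
have [M HM] := im_bound hc (mulr_gt0 (ltr0Sn R 1) eps0).
near=> m.
have m0 : (0 < m)%N by near: m; exists 1%N.
have Mm : (M <= m)%N by near: m; exists M.
have mR : 0 < m%:R :> R by rewrite ltr0n.
have sup0 : 0 <= sup (E m) by apply: sup_upper_bound => //; right.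
rewrite ger0_norm // ger0_norm ?invr_ge0 //.
apply: ge_sup => // x [[_ [lambda [ev re ->]]]|->]; last first.
  by rewrite mulr_ge0 ?invr_ge0 // ltW.
have [mu [remu <- rec]] := pencil_eigenvalue_normRe m0 ev.
rewrite -remu in re *; have := HM m mu Mm rec re.
rewrite lerBlDr => h.
have m2 : 0 < 2 * m%:R :> R by rewrite mulr_gt0.
rewrite -(ler_pM2l m2); apply: (le_trans h).
rewrite le_eqVlt; apply/orP; left; apply/eqP; field.
by rewrite gt_eqF.
Unshelve. all: by end_near.
Qed.
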